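(* Let $(X,d)$ be a Cantor space. Then the set of $f\in\mathcal{H}(X)$ that are not topologically stable contains a dense $G_\delta$ subset of $(\mathcal{H}(X),D)$; that is, a generic homeomorphism of $X$ is not topologically stable.
   Context: A Cantor space is a compact metric space without isolated points that is totally disconnected. $\mathcal{H}(X)$ is the set of homeomorphisms; $d_{C^0}(f,g)=\sup_x d(f(x),g(x))$; $D(f,g)=\max\{d_{C^0}(f,g),d_{C^0}(f^{-1},g^{-1})\}$. $f\in\mathcal{H}(X)$ is topologically stable if for every $\epsilon>0$ there is $\delta>0$ such that every $g\in\mathcal{H}(X)$ with $D(f,g)<\delta$ admits a continuous $h:X\to X$ with $d_{C^0}(h,\mathrm{id}_X)<\epsilon$ and $h\circ g=f\circ h$. *)

(* Defs.v *)
From Stdlib Require Import Reals Lra List Classical ClassicalEpsilon.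
Open Scope R_scope.

Record MetricSpace := {
  carrier :> Type;
  dist : carrier -> carrier -> R;
  dist_eq0 : forall x y, dist x y = 0 <-> x = y;
  dist_sym : forall x y, dist x y = dist y x;
  dist_tri : forall x y z, dist x z <= dist x y + dist y z
}.

Arguments dist {_} _ _.

Section Metric.
Variable X : MetricSpace.

Definition is_open (U : X -> Prop) : Prop :=
  forall x, U x -> exists r, r > 0 /\ forall y, dist x y < r -> U y.

Definition compact_space : Prop :=
  forall (I : Type) (U : I -> X -> Prop),
    (forall i, is_open (U i)) ->
    (forall x, exists i, U i x) ->
    exists l : list I, forall x, exists i, In i l /\ U i x.

Definition no_isolated_points : Prop :=
  forall (x : X) (r : R), r > 0 -> exists y : X, y <> x /\ dist x y < r.

Definition connected (A : X -> Prop) : Prop :=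
  forall U V : X -> Prop, is_open U -> is_open V ->
    (forall x, A x -> U x \/ V x) ->
    (forall x, A x -> U x -> V x -> False) ->
    (forall x, A x -> U x) \/ (forall x, A x -> V x).

Definition totally_disconnected : Prop :=
  forall A : X -> Prop, connected A -> forall x y, A x -> A y -> x = y.

Definition cantor_space : Prop :=
  inhabited X /\ compact_space /\ no_isolated_points /\ totally_disconnected.

Definition continuous (f : X -> X) : Prop :=
  forall x eps, eps > 0 -> exists delta, delta > 0 /\
    forall y, dist x y < delta -> dist (f x) (f y) < eps.

Record homeo := {
  hf : X -> X;
  hinv : X -> X;
  hinv_hf : forall x, hinv (hf x) = x;
  hf_hinv : forall x, hf (hinv x) = x;
  hf_cont : continuous hf;
  hinv_cont : continuous hinv
}.

(** supremum of a set of reals (its least upper bound when it is nonempty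
    and bounded above; 0 otherwise — never used in that case for compact X) *)
Definition sup_R (E : R -> Prop) : R :=
  match excluded_middle_informative
          ((exists m, is_upper_bound E m) /\ (exists x, E x)) with
  | left H =>
      proj1_sig (completeness E (proj1 H) (proj2 H))
  | right _ => 0
  end.

Definition dC0 (f g : X -> X) : R :=
  sup_R (fun r => exists x, r = dist (f x) (g x)).

Definition Dh (f g : homeo) : R :=
  Rmax (dC0 (hf f) (hf g)) (dC0 (hinv f) (hinv g)).

Definition topologically_stable (f : homeo) : Prop :=
  forall eps, eps > 0 -> exists delta, delta > 0 /\
    forall g : homeo, Dh f g < delta ->
      exists h : X -> X, continuous h /\ dC0 h (fun x => x) < eps /\
        forall x, h (hf g x) = hf f (h x).

Definition H_open (U : homeo -> Prop) : Prop :=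
  forall f, U f -> exists r, r > 0 /\ forall g, Dh f g < r -> U g.

Definition H_dense (G : homeo -> Prop) : Prop :=
  forall f r, r > 0 -> exists g, G g /\ Dh f g < r.

Definition H_Gdelta (G : homeo -> Prop) : Prop :=
  exists U : nat -> homeo -> Prop,
    (forall n, H_open (U n)) /\ (forall g, G g <-> forall n, U n g).

End Metric.

(* Main.v *)
(** A generic homeomorphism is aperiodic, and an aperiodic [f] is a limit of homeomorphisms [g]
    having a periodic point [y]; if [h o g = f o h] then [h y] is periodic for [f], which is
    absurd.  To find [g], take [y] with [f^n y] close to [y] and a small clopen neighbourhood [A]
    of [y], and compose [f] with the involution exchanging [A] and [f^n A] by means of [f^n].
    Aperiodic homeomorphisms form a G_delta because having no point of period [n] is an open
    condition.  They are dense because a Cantor space [X] is homeomorphic to [2^N], hence to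
    [X x 2^N] with a projection to [X] that is arbitrarily close to the identity: there the
    product of [f] and the odometer is aperiodic and close to [f]. *)
From Stdlib Require Import Reals Lra Lia List Bool Cantor Classical ClassicalEpsilon
  FunctionalExtensionality.
Require Import Defs.
Open Scope R_scope.

Arguments hf {X} _ _.
Arguments hinv {X} _ _.

(** * Metric preliminaries, compactness and the uniform distance *)

Lemma dist_refl (X : MetricSpace) (x : X) : dist x x = 0.
Proof. now apply dist_eq0. Qed.

Lemma dist_ge0 (X : MetricSpace) (x y : X) : 0 <= dist x y.
Proof.
  pose proof (dist_tri X x y x) as H.
  rewrite (dist_refl X x), (dist_sym X y x) in H; lra.
Qed.

Lemma dist_gt0 (X : MetricSpace) (x y : X) : x <> y -> 0 < dist x y.
Proof.
  intros H. destruct (dist_ge0 X x y) as [|E]; auto.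
  exfalso. apply H, dist_eq0. auto.
Qed.

Lemma ball_open (X : MetricSpace) (x : X) (r : R) : is_open X (fun y => dist x y < r).
Proof.
  intros y Hy. exists (r - dist x y). split; [lra|].
  intros z Hz. pose proof (dist_tri X x y z). lra.
Qed.

Lemma exists_nat_above (x : R) : exists n : nat, x < INR n.
Proof.
  destruct (INR_unbounded x) as [n Hn]. exists n. lra.
Qed.

(** Lebesgue-number principle: finitely many of the given balls cover [X], and by monotonicity in
    [r] their least radius serves everywhere. Most compactness arguments below take this form. *)
Lemma compact_uniform (X : MetricSpace) (P : X -> R -> Prop) :
  compact_space X ->
  (forall x r r', 0 < r' <= r -> P x r -> P x r') ->
  (forall x, exists r, r > 0 /\ forall y, dist x y < r -> P y r) ->
  exists r, r > 0 /\ forall y, P y r.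
Proof.
  intros HC Hmono Hloc.
  (* Every pair of a centre and a radius is an index; pairs without the local property index the
     empty set. *)
  destruct (HC (X * R)%type
    (fun i y => (0 < snd i /\ forall z, dist (fst i) z < snd i -> P z (snd i)) /\
                dist (fst i) y < snd i)) as [l Hl].
  - intros [c r] x [H1 H2]. destruct (ball_open X c r x H2) as [r' [Hr' H]].
    exists r'. split; [auto|]. intros y Hy. split; [exact H1|]. now apply H.
  - intros x. destruct (Hloc x) as [r [Hr H]]. exists (x, r). simpl.
    rewrite dist_refl. auto.
  - assert (Hmin : exists r, r > 0 /\ forall i, In i l -> 0 < snd i -> r <= snd i).
    { clear Hl. induction l as [|[c r] l [r0 [Hr0 IH]]].
      - exists 1. split; [lra|]. intros i [].
      - destruct (Rlt_dec 0 r) as [Hr|Hr].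
        + exists (Rmin r r0). split; [apply Rmin_glb_lt; lra|].
          intros i [<-|Hi] Hp; simpl.
          * apply Rmin_l.
          * eapply Rle_trans; [apply Rmin_r|]. auto.
        + exists r0. split; [auto|]. intros i [<-|Hi] Hp; simpl in *; [lra|auto]. }
    destruct Hmin as [r [Hr Hmin]]. exists r. split; [auto|].
    intros y. destruct (Hl y) as [i [Hi [[H1 H2] H3]]].
    apply (Hmono y (snd i)); auto.
Qed.

Lemma uniform_continuity (X : MetricSpace) (f : X -> X) (eps : R) :
  compact_space X -> continuous X f -> eps > 0 ->
  exists delta, delta > 0 /\ forall x y, dist x y < delta -> dist (f x) (f y) < eps.
Proof.
  intros HC Hf He.
  destruct (compact_uniform X
    (fun x r => forall y, dist x y < r -> dist (f x) (f y) < eps) HC) as [r [Hr H]].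
  - intros x r r' Hr H y Hy. apply H. lra.
  - intros x. destruct (Hf x (eps / 2)) as [r [Hr H]]; [lra|].
    exists (r / 2). split; [lra|]. intros y Hy z Hz.
    pose proof (H y ltac:(lra)) as H1.
    pose proof (dist_tri X x y z).
    pose proof (H z ltac:(lra)) as H2.
    pose proof (dist_tri X (f y) (f x) (f z)) as H3.
    rewrite (dist_sym X (f y) (f x)) in H3. lra.
  - exists r. auto.
Qed.

(** Without a cluster point, each point has a ball that [u] eventually avoids. Writing eventually as
    [/ r < INR i] makes this monotone in [r], so [u] would eventually avoid all of [X]. *)
Lemma compact_cluster (X : MetricSpace) (u : nat -> X) :
  compact_space X ->
  exists z, forall r n, r > 0 -> exists i, (n <= i)%nat /\ dist z (u i) < r.
Proof.
  intros HC. apply NNPP. intros Hno.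
  destruct (compact_uniform X
    (fun y r => forall i, / r < INR i -> u i <> y) HC) as [r [Hr H]].
  - intros x r r' Hr H i Hi. apply H.
    eapply Rle_lt_trans; [|apply Hi].
    apply Rinv_le_contravar; lra.
  - intros z. apply NNPP. intros Hz. apply Hno. exists z. intros r n Hr.
    apply NNPP. intros Hi. apply Hz.
    assert (Hn : 0 < INR (S n)) by (apply lt_0_INR; lia).
    exists (Rmin r (/ INR (S n))).
    assert (Hpos : 0 < Rmin r (/ INR (S n))).
    { apply Rmin_glb_lt; [auto|]. now apply Rinv_0_lt_compat. }
    split; [exact Hpos|].
    intros y Hy i Hin Heq. apply Hi. exists i. split.
    + assert (INR (S n) < INR i) as Hlt.
      { eapply Rle_lt_trans; [|apply Hin].
        rewrite <- (Rinv_inv (INR (S n))) at 1.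
        apply Rinv_le_contravar; [auto|apply Rmin_r]. }
      apply INR_lt in Hlt. lia.
    + rewrite Heq. eapply Rlt_le_trans; [apply Hy|apply Rmin_l].
  - destruct (exists_nat_above (/ r)) as [n Hn]. exact (H (u n) n Hn eq_refl).
Qed.

Lemma compact_bounded (X : MetricSpace) :
  compact_space X -> exists M, forall x y : X, dist x y <= M.
Proof.
  intros HC. destruct (classic (inhabited X)) as [[x0]|Hno].
  2:{ exists 0. intros x. exfalso. apply Hno. now constructor. }
  (* The bound is encoded as [/ r], which grows as [r] shrinks. *)
  destruct (compact_uniform X (fun y r => dist x0 y < / r) HC) as [r [Hr H]].
  - intros x r r' Hr H. eapply Rlt_le_trans; [apply H|]. apply Rinv_le_contravar; lra.
  - intros x. pose proof (dist_ge0 X x0 x).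
    exists (Rmin 1 (/ (dist x0 x + 1))).
    assert (Hp : 0 < Rmin 1 (/ (dist x0 x + 1))).
    { apply Rmin_glb_lt; [lra|]. apply Rinv_0_lt_compat; lra. }
    split; [exact Hp|]. intros y Hy.
    pose proof (dist_tri X x0 x y).
    assert (dist x y < 1) by (eapply Rlt_le_trans; [apply Hy|apply Rmin_l]).
    eapply Rlt_le_trans with (dist x0 x + 1); [lra|].
    rewrite <- (Rinv_inv (dist x0 x + 1)) at 1.
    apply Rinv_le_contravar; [auto|apply Rmin_r].
  - exists (2 * / r). intros x y.
    pose proof (H x). pose proof (H y). pose proof (dist_tri X x x0 y).
    rewrite (dist_sym X x x0) in *. lra.
Qed.

(** Compactness bounds the distances, so [sup_R] is here a true supremum and not its default 0. *)
Lemma dC0_lt_dist (X : MetricSpace) (f g : X -> X) (r : R) (x : X) :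
  compact_space X -> dC0 X f g < r -> dist (f x) (g x) < r.
Proof.
  intros HC. unfold dC0, sup_R.
  destruct excluded_middle_informative as [H|H].
  - destruct completeness as [m [Hm Hlub]]; simpl. intros Hr.
    eapply Rle_lt_trans; [|apply Hr]. apply Hm. eauto.
  - exfalso. apply H. split; [|exists (dist (f x) (g x)), x; reflexivity].
    destruct (compact_bounded X HC) as [M HM]. exists M. intros r' [y ->]. auto.
Qed.

Lemma dC0_le (X : MetricSpace) (f g : X -> X) (r : R) :
  0 <= r -> (forall x, dist (f x) (g x) <= r) -> dC0 X f g <= r.
Proof.
  intros Hr H. unfold dC0, sup_R.
  (* In the default case [dC0] is 0, whence the assumption [0 <= r]. *)
  destruct excluded_middle_informative as [H1|H1]; [|exact Hr].
  destruct completeness as [m [Hub Hm]]; simpl.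
  apply Hm. intros r' [x ->]. auto.
Qed.

Lemma Dh_lt (X : MetricSpace) (f g : homeo X) (r : R) :
  r > 0 ->
  (forall x, dist (hf f x) (hf g x) < r / 2) ->
  (forall x, dist (hinv f x) (hinv g x) < r / 2) -> Dh X f g < r.
Proof.
  intros Hr H1 H2. unfold Dh. apply Rle_lt_trans with (r / 2); [|lra].
  apply Rmax_lub; apply dC0_le; try lra; intros x; apply Rlt_le; auto.
Qed.

Lemma continuous_comp (X : MetricSpace) (f g : X -> X) :
  continuous X f -> continuous X g -> continuous X (fun x => f (g x)).
Proof.
  intros Hf Hg x eps He.
  destruct (Hf (g x) eps He) as [r [Hr H]].
  destruct (Hg x r Hr) as [r' [Hr' H']]. exists r'. auto.
Qed.

Lemma continuous_iter (X : MetricSpace) (f : X -> X) (n : nat) :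
  continuous X f -> continuous X (Nat.iter n f).
Proof.
  intros Hf. induction n as [|n IH].
  - intros x eps He. exists eps. auto.
  - exact (continuous_comp X f (Nat.iter n f) Hf IH).
Qed.

Lemma iter_semiconj {A B : Type} (p : A -> B) (F : A -> A) (H : B -> B) (n : nat) (x : A) :
  (forall a, p (F a) = H (p a)) -> p (Nat.iter n F x) = Nat.iter n H (p x).
Proof.
  intros E. induction n as [|n IH]; simpl; [reflexivity|]. now rewrite E, IH.
Qed.

Lemma iter_cancel {A : Type} (f g : A -> A) (n : nat) (x : A) :
  (forall a, g (f a) = a) -> Nat.iter n g (Nat.iter n f x) = x.
Proof.
  intros E. induction n as [|n IH]; [reflexivity|].
  rewrite Nat.iter_succ_r. simpl. now rewrite E.
Qed.

Definition aperiodic {A : Type} (f : A -> A) : Prop :=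
  forall n x, Nat.iter (S n) f x <> x.

(** * Openness of the set of homeomorphisms without points of a given period *)

(** Joint continuity of the [n]-th iterate in the map and the point. *)
Lemma iter_close (X : MetricSpace) (f : X -> X) (n : nat) (x : X) (eps : R) :
  continuous X f -> eps > 0 ->
  exists r, r > 0 /\ forall (g : X -> X) y,
    (forall z, dist (f z) (g z) < r) -> dist x y < r ->
    dist (Nat.iter n f x) (Nat.iter n g y) < eps.
Proof.
  intros Hf. revert eps. induction n as [|n IH]; intros eps He.
  - exists eps. auto.
  - destruct (Hf (Nat.iter n f x) (eps / 2)) as [r [Hr H]]; [lra|].
    destruct (IH r Hr) as [r' [Hr' H']].
    exists (Rmin r' (eps / 2)). split; [apply Rmin_glb_lt; lra|].
    intros g y Hg Hy. simpl.
    assert (H1 : forall z, dist (f z) (g z) < r').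
    { intros z. eapply Rlt_le_trans; [apply Hg|apply Rmin_l]. }
    assert (H2 : dist x y < r') by (eapply Rlt_le_trans; [apply Hy|apply Rmin_l]).
    pose proof (H _ (H' g y H1 H2)).
    pose proof (Rlt_le_trans _ _ _ (Hg (Nat.iter n g y)) (Rmin_r _ _)).
    pose proof (dist_tri X (f (Nat.iter n f x)) (f (Nat.iter n g y)) (g (Nat.iter n g y))).
    lra.
Qed.

(** If [f^n] moves [x], then [g^n] moves [y] for all [g] near [f] and [y] near [x]; compactness
    makes the radius independent of [x]. *)
Lemma no_period_open (X : MetricSpace) (n : nat) :
  compact_space X -> H_open X (fun f => forall x, Nat.iter n (hf f) x <> x).
Proof.
  intros HC f Hf.
  destruct (compact_uniform X
    (fun y r => forall g : X -> X, (forall z, dist (hf f z) (g z) < r) ->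
       Nat.iter n g y <> y) HC) as [r [Hr H]].
  - intros x r r' Hr H g Hg. apply H. intros z. specialize (Hg z). lra.
  - intros x.
    assert (Hd : 0 < dist x (Nat.iter n (hf f) x)).
    { apply dist_gt0. intros E. exact (Hf x (eq_sym E)). }
    set (eps := dist x (Nat.iter n (hf f) x)) in *.
    destruct (iter_close X (hf f) n x (eps / 2) (hf_cont X f)) as [r [Hr H]]; [lra|].
    exists (Rmin r (eps / 2)). split; [apply Rmin_glb_lt; lra|].
    intros y Hy g Hg E.
    assert (H1 : forall z, dist (hf f z) (g z) < r).
    { intros z. eapply Rlt_le_trans; [apply Hg|apply Rmin_l]. }
    pose proof (Rlt_le_trans _ _ _ Hy (Rmin_l _ _)) as H2.
    pose proof (Rlt_le_trans _ _ _ Hy (Rmin_r _ _)) as H3.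
    pose proof (H g y H1 H2) as H4. rewrite E in H4.
    pose proof (dist_tri X x y (Nat.iter n (hf f) x)) as H5.
    rewrite (dist_sym X y) in H5. unfold eps in *. lra.
  - exists r. split; [auto|]. intros g Hg x. apply H. intros z.
    apply (dC0_lt_dist X (hf f) (hf g) r z HC).
    eapply Rle_lt_trans; [apply Rmax_l|apply Hg].
Qed.

(** * Clopen sets *)

(** Clopen sets are locally constant Boolean functions, so membership can be computed with and split
    on. *)
Definition clopen (X : MetricSpace) (A : X -> bool) : Prop :=
  forall x, exists r, r > 0 /\ forall y, dist x y < r -> A y = A x.

Lemma clopen_const (X : MetricSpace) (b : bool) : clopen X (fun _ => b).
Proof. intros x. exists 1. split; [lra|auto]. Qed.

Lemma clopen_map2 (X : MetricSpace) (op : bool -> bool -> bool) (A B : X -> bool) :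
  clopen X A -> clopen X B -> clopen X (fun x => op (A x) (B x)).
Proof.
  intros HA HB x.
  destruct (HA x) as [r [Hr H]]. destruct (HB x) as [s [Hs K]].
  exists (Rmin r s). split; [apply Rmin_glb_lt; auto|].
  intros y Hy. rewrite H, K; auto.
  - eapply Rlt_le_trans; [apply Hy|apply Rmin_r].
  - eapply Rlt_le_trans; [apply Hy|apply Rmin_l].
Qed.

Lemma clopen_preimage (X : MetricSpace) (A : X -> bool) (f : X -> X) :
  clopen X A -> continuous X f -> clopen X (fun x => A (f x)).
Proof.
  intros HA Hf x. destruct (HA (f x)) as [r [Hr H]].
  destruct (Hf x r Hr) as [s [Hs K]]. exists s. auto.
Qed.

Lemma clopen_cluster (X : MetricSpace) (A : X -> bool) (u : nat -> X) (z : X) (n : nat) :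
  clopen X A ->
  (forall r n, r > 0 -> exists i, (n <= i)%nat /\ dist z (u i) < r) ->
  (forall i, (n <= i)%nat -> A (u i) = true) -> A z = true.
Proof.
  intros HA Hz Hu. destruct (HA z) as [r [Hr H]].
  destruct (Hz r n Hr) as [i [Hi Hd]]. rewrite <- (H _ Hd). auto.
Qed.

Definition quasi_component (X : MetricSpace) (x y : X) : Prop :=
  forall D, clopen X D -> D x = true -> D y = true.

(** [O] and the complements of the clopen sets around [x] cover [X]; the clopen sets in a finite
    subcover intersect inside [O]. *)
Lemma quasi_component_nbhd (X : MetricSpace) (x : X) (O : X -> Prop) :
  compact_space X -> is_open X O -> (forall y, quasi_component X x y -> O y) ->
  exists D, clopen X D /\ D x = true /\ forall y, D y = true -> O y.
Proof.
  intros HC HO HQ.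
  destruct (HC (X -> bool)
    (fun D y => O y \/ (clopen X D /\ D x = true /\ D y = false))) as [l Hl].
  - intros D y [Hy|[H1 [H2 H3]]].
    + destruct (HO y Hy) as [r [Hr H]]. exists r. auto.
    + destruct (H1 y) as [r [Hr H]]. exists r. split; [auto|].
      intros z Hz. right. rewrite (H z Hz). auto.
  - intros y. destruct (classic (quasi_component X x y)) as [Hq|Hq].
    + exists (fun _ => true). left. auto.
    + apply not_all_ex_not in Hq. destruct Hq as [D Hq]. exists D. right.
      apply imply_to_and in Hq. destruct Hq as [H1 Hq].
      apply imply_to_and in Hq. destruct Hq as [H2 Hq].
      apply not_true_is_false in Hq. auto.
  - assert (Hint : exists E, clopen X E /\ E x = true /\ forall y, E y = true ->
               forall D, In D l -> clopen X D -> D x = true -> D y = true).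
    { clear Hl. induction l as [|D l [E [HE [Hx IH]]]].
      - exists (fun _ => true). split; [apply clopen_const|]. split; [auto|].
        intros y _ D [].
      - destruct (classic (clopen X D /\ D x = true)) as [[HD HDx]|HD].
        + exists (fun y => D y && E y). split; [now apply clopen_map2|].
          rewrite HDx, Hx. split; [auto|]. intros y Hy.
          apply andb_prop in Hy. destruct Hy as [Hy1 Hy2].
          intros D' [<-|HD'] H1 H2; [auto|]. now apply (IH y Hy2).
        + exists E. split; [auto|]. split; [auto|]. intros y Hy D' [<-|HD'] H1 H2.
          * exfalso. auto.
          * now apply (IH y Hy). }
    destruct Hint as [E [HE [Hx H]]]. exists E. split; [auto|]. split; [auto|].
    intros y Hy. destruct (Hl y) as [D [HD [HOy|[H1 [H2 H3]]]]]; [auto|].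
    rewrite (H y Hy D HD H1 H2) in H3. discriminate.
Qed.

(* Open sets disjoint on [Q] are shrunk to halves of balls, which are disjoint in all of [X]. *)
Definition half_nbhd (X : MetricSpace) (Q U : X -> Prop) (y : X) : Prop :=
  exists u r, Q u /\ r > 0 /\ (forall z, dist u z < r -> U z) /\ dist u y < r / 2.

Lemma half_nbhd_open (X : MetricSpace) (Q U : X -> Prop) : is_open X (half_nbhd X Q U).
Proof.
  intros y (u & r & H1 & H2 & H3 & H4).
  destruct (ball_open X u (r / 2) y H4) as [s [Hs H]].
  exists s. split; [auto|]. intros z Hz. exists u, r. auto.
Qed.

Lemma half_nbhd_self (X : MetricSpace) (Q U : X -> Prop) (y : X) :
  is_open X U -> Q y -> U y -> half_nbhd X Q U y.
Proof.
  intros HU HQ Hy. destruct (HU y Hy) as [r [Hr H]]. exists y, r.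
  rewrite dist_refl. repeat split; auto; lra.
Qed.

(** If two half balls meet, their centres are closer than the larger radius, so one centre lies in
    both [U] and [V]. *)
Lemma half_nbhd_disjoint (X : MetricSpace) (Q U V : X -> Prop) (y : X) :
  (forall x, Q x -> U x -> V x -> False) ->
  half_nbhd X Q U y -> half_nbhd X Q V y -> False.
Proof.
  intros HUV (u & r & H1 & H2 & H3 & H4) (v & s & K1 & K2 & K3 & K4).
  pose proof (dist_tri X u y v) as T. rewrite (dist_sym X y v) in T.
  assert (Hu : U u) by (apply H3; rewrite dist_refl; lra).
  assert (Hv : V v) by (apply K3; rewrite dist_refl; lra).
  destruct (Rle_dec s r).
  - apply (HUV v K1); [|auto]. apply H3. lra.
  - apply (HUV u H1); [auto|]. apply K3. rewrite dist_sym. lra.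
Qed.

(** A separation of the quasi-component extends to disjoint open sets [U'] and [V'], whose union
    contains a clopen [D] around [x]. Then [D] cut by [U'] is clopen and contains [x], so it
    contains the whole quasi-component. *)
Lemma quasi_component_connected (X : MetricSpace) (x : X) :
  compact_space X -> connected X (quasi_component X x).
Proof.
  intros HC.
  assert (Key : forall U V : X -> Prop, is_open X U -> is_open X V ->
    (forall y, quasi_component X x y -> U y \/ V y) ->
    (forall y, quasi_component X x y -> U y -> V y -> False) ->
    U x -> forall y, quasi_component X x y -> U y).
  { intros U V HU HV Hcov Hdis Hx y Hy.
    set (Q := quasi_component X x) in *.
    assert (HQx : Q x) by (intros D; auto).
    set (U' := half_nbhd X Q U). set (V' := half_nbhd X Q V).
    destruct (quasi_component_nbhd X x (fun z => U' z \/ V' z) HC) as (D & HD & HDx & H).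
    - intros z [Hz|Hz]; [destruct (half_nbhd_open X Q U z Hz) as [r [Hr K]]
                        |destruct (half_nbhd_open X Q V z Hz) as [r [Hr K]]];
        exists r; (split; [exact Hr|]); intros w Hw; [left|right]; exact (K w Hw).
    - intros z Hz. destruct (Hcov z Hz); [left|right]; apply half_nbhd_self; auto.
    (* [E] is clopen because its complement in [D] is the part of [D] in [V']. *)
    - set (E := fun z => if excluded_middle_informative (D z = true /\ U' z)
                         then true else false).
      assert (HE : clopen X E).
      { intros z. destruct (HD z) as [r [Hr Hz]].
        destruct (D z) eqn:Dz.
        - destruct (H z Dz) as [Hz'|Hz'].
          + destruct (half_nbhd_open X Q U z Hz') as [s [Hs K]].
            exists (Rmin r s). split; [apply Rmin_glb_lt; auto|].
            intros w Hw.
            pose proof (Hz w (Rlt_le_trans _ _ _ Hw (Rmin_l _ _))).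
            pose proof (K w (Rlt_le_trans _ _ _ Hw (Rmin_r _ _))).
            unfold E. do 2 destruct excluded_middle_informative; tauto.
          + destruct (half_nbhd_open X Q V z Hz') as [s [Hs K]].
            exists s. split; [auto|]. intros w Hw. unfold E.
            pose proof (half_nbhd_disjoint X Q U V z Hdis).
            pose proof (half_nbhd_disjoint X Q U V w Hdis).
            pose proof (K w Hw).
            do 2 destruct excluded_middle_informative; tauto.
        - exists r. split; [auto|]. intros w Hw. unfold E. rewrite (Hz w Hw), Dz.
          do 2 destruct excluded_middle_informative; intuition discriminate. }
      assert (HEx : E x = true).
      { unfold E. destruct excluded_middle_informative as [|N]; [auto|].
        exfalso. apply N. split; [auto|]. now apply half_nbhd_self. }
      pose proof (Hy E HE HEx) as HEy. unfold E in HEy.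
      destruct excluded_middle_informative as [[_ Hy']|]; [|discriminate].
      destruct (Hcov y Hy) as [|Hv]; [auto|]. exfalso.
      apply (half_nbhd_disjoint X Q U V y Hdis Hy'). now apply half_nbhd_self. }
  intros U V HU HV Hcov Hdis.
  destruct (Hcov x) as [Hx|Hx]; [intros D; auto|left|right].
  - now apply (Key U V).
  - apply (Key V U); auto.
    + intros y Hy. destruct (Hcov y Hy); auto.
    + intros y Hy Hv Hu. exact (Hdis y Hy Hu Hv).
Qed.

Lemma quasi_component_eq (X : MetricSpace) (x y : X) :
  compact_space X -> totally_disconnected X -> quasi_component X x y -> y = x.
Proof.
  intros HC HT Hy. apply (HT _ (quasi_component_connected X x HC)); [auto|].
  intros D; auto.
Qed.

Lemma clopen_base (X : MetricSpace) (x : X) (r : R) :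
  compact_space X -> totally_disconnected X -> r > 0 ->
  exists D, clopen X D /\ D x = true /\ forall y, D y = true -> dist x y < r.
Proof.
  intros HC HT Hr.
  apply (quasi_component_nbhd X x (fun y => dist x y < r) HC (ball_open X x r)).
  intros y Hy. rewrite (quasi_component_eq X x y HC HT Hy), dist_refl. auto.
Qed.

(** * Brouwer's coding of a Cantor space by binary sequences *)

Definition agree (n : nat) (s t : nat -> bool) : Prop :=
  forall k, (k < n)%nat -> s k = t k.

(** For each [n] take a finite cover by clopen sets of diameter at most [/ INR (S n)], and list all
    members of all covers in one sequence. *)
Lemma separating_clopens (X : MetricSpace) :
  compact_space X -> totally_disconnected X ->
  exists B : nat -> X -> bool,
    (forall n, clopen X (B n)) /\ forall x y, (forall n, B n x = B n y) -> x = y.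
Proof.
  intros HC HT.
  set (cover := fun n (l : list (X -> bool)) =>
    (forall D, In D l -> clopen X D /\
       forall y z, D y = true -> D z = true -> dist y z < / INR (S n)) /\
    forall x, exists D, In D l /\ D x = true).
  assert (Hcov : forall n, exists l, cover n l).
  { intros n.
    assert (Hn : 0 < / INR (S n)) by (apply Rinv_0_lt_compat, lt_0_INR; lia).
    set (e := / INR (S n)) in *.
    set (small := fun D : X -> bool => clopen X D /\
       forall y z, D y = true -> D z = true -> dist y z < e).
    destruct (HC (X -> bool) (fun D y => small D /\ D y = true)) as [l Hl].
    - intros D x [HD Hx]. destruct (proj1 HD x) as [r [Hr H]].
      exists r. split; [auto|]. intros y Hy. split; [auto|]. now rewrite (H y Hy).
    - intros x. destruct (clopen_base X x (e / 2) HC HT) as (D & HD & HDx & H); [lra|].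
      exists D. split; [split; [auto|]|auto].
      intros y z Hy Hz. pose proof (H y Hy). pose proof (H z Hz).
      pose proof (dist_tri X y x z). rewrite (dist_sym X y x) in *. lra.
    (* The subcover may list sets that are not small; they cover nothing and are dropped. *)
    - exists (filter (fun D => if excluded_middle_informative (small D)
                               then true else false) l).
      split.
      + intros D HD. apply filter_In in HD. destruct HD as [_ HD].
        destruct excluded_middle_informative; [auto|discriminate].
      + intros x. destruct (Hl x) as [D [HD [H1 H2]]]. exists D. split; [|auto].
        apply filter_In. split; [auto|].
        destruct excluded_middle_informative; tauto. }
  set (cv := fun n => proj1_sig (constructive_indefinite_description _ (Hcov n))).
  assert (Hcv : forall n, cover n (cv n)).
  { intros n. unfold cv. apply proj2_sig. }
  (* Cantor pairing decodes [k] as a cover and a position in it; past the end of the list stands the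
     whole space, which is clopen. *)
  exists (fun k => nth (snd (of_nat k)) (cv (fst (of_nat k))) (fun _ => true)).
  split.
  - intros k. destruct (of_nat k) as [n i]; simpl.
    destruct (nth_in_or_default i (cv n) (fun _ => true)) as [Hin| ->].
    + now apply (Hcv n).
    + apply clopen_const.
  - intros x y H. apply NNPP. intros Hxy. apply dist_gt0 in Hxy.
    destruct (exists_nat_above (/ dist x y)) as [n Hn].
    destruct (Hcv n) as [H1 H2]. destruct (H2 x) as [D [HD Hx]].
    destruct (In_nth (cv n) D (fun _ => true) HD) as [i [_ Hi]].
    specialize (H (to_nat (n, i))). rewrite cancel_of_to in H. simpl in H.
    rewrite Hi, Hx in H.
    pose proof (proj2 (H1 D HD) x y Hx (eq_sym H)) as Hd.
    assert (/ INR (S n) <= dist x y); [|lra].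
    rewrite <- (Rinv_inv (dist x y)).
    apply Rinv_le_contravar; [now apply Rinv_0_lt_compat|].
    rewrite S_INR. lra.
Qed.

(* [S = B] whenever [B] itself cuts [A], so that a set [B] used once never separates two
   points of the same cell afterwards. *)
Definition splits (X : MetricSpace) (A B S : X -> bool) : Prop :=
  clopen X S /\
  (forall b, exists y, A y = true /\ S y = b) /\
  ((forall b, exists y, A y = true /\ B y = b) -> S = B).

(** When [B] does not cut [A], a second point of [A] exists for lack of isolated points, and a
    clopen set separates it from [p]. *)
Lemma splits_exist (X : MetricSpace) (A B : X -> bool) (p : X) :
  compact_space X -> totally_disconnected X -> no_isolated_points X ->
  clopen X A -> clopen X B -> A p = true -> exists S, splits X A B S.
Proof.
  intros HC HT HI HA HB Hp.
  destruct (classic (forall b, exists y, A y = true /\ B y = b)) as [H|H].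
  - exists B. split; auto.
  - destruct (HA p) as [r [Hr Hball]]. destruct (HI p r Hr) as [q [Hq Hpq]].
    destruct (clopen_base X p (dist p q) HC HT) as (D & HD & HDp & HDq).
    { apply dist_gt0. congruence. }
    exists D. split; [auto|]. split; [|tauto].
    intros [|]; [exists p; auto|]. exists q. rewrite (Hball q Hpq). split; [auto|].
    apply not_true_is_false. intros E. specialize (HDq q E). lra.
Qed.

(** The cells form a binary tree of partitions. Words carry the latest choice at the head, so
    [length w'] is the depth of the cut being made. *)
Fixpoint cell {T : Type} (B : nat -> T -> bool)
    (sigma : (T -> bool) -> (T -> bool) -> T -> bool) (w : list bool) : T -> bool :=
  match w with
  | nil => fun _ => true
  | b :: w' => fun y =>
      cell B sigma w' y && Bool.eqb (sigma (cell B sigma w') (B (length w')) y) b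
  end.

Fixpoint prefix (s : nat -> bool) (n : nat) : list bool :=
  match n with 0%nat => nil | S n => s n :: prefix s n end.

Lemma prefix_length (s : nat -> bool) (n : nat) : length (prefix s n) = n.
Proof. induction n; simpl; auto. Qed.

Lemma prefix_eq_agree (s t : nat -> bool) (n : nat) :
  prefix s n = prefix t n <-> agree n s t.
Proof.
  induction n as [|n IH]; simpl.
  - split; [intros _ k Hk; lia|auto].
  - split.
    + intros [= H1 H2] k Hk. apply IH in H2.
      destruct (Nat.eq_dec k n) as [->|]; [auto|]. apply H2. lia.
    + intros H. f_equal; [apply H; lia|]. apply IH. intros k Hk. apply H. lia.
Qed.

Fixpoint address {T : Type} (B : nat -> T -> bool)
    (sigma : (T -> bool) -> (T -> bool) -> T -> bool) (x : T) (n : nat) : list bool :=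
  match n with
  | 0%nat => nil
  | S n => sigma (cell B sigma (address B sigma x n)) (B n) x :: address B sigma x n
  end.

Definition code {T : Type} (B : nat -> T -> bool)
    (sigma : (T -> bool) -> (T -> bool) -> T -> bool) (x : T) (n : nat) : bool :=
  sigma (cell B sigma (address B sigma x n)) (B n) x.

(** At each depth [x] lies in exactly one cell, that of its [address], and the address is the prefix
    of its code. *)
Lemma cell_prefix_iff {T : Type} B sigma (s : nat -> bool) (n : nat) (x : T) :
  cell B sigma (prefix s n) x = true <-> agree n s (code B sigma x).
Proof.
  assert (Hpre : forall m, prefix (code B sigma x) m = address B sigma x m).
  { intros m. induction m as [|m IH]; simpl; [auto|]. rewrite IH. reflexivity. }
  rewrite <- prefix_eq_agree, Hpre.
  induction n as [|n IH]; simpl; [tauto|].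
  rewrite andb_true_iff, IH, prefix_length, eqb_true_iff.
  split.
  - intros [H1 H2]. rewrite <- H2, H1. reflexivity.
  - intros [= H1 H2]. rewrite H2, H1. auto.
Qed.

(** The code follows a point down the tree of cells. The last two clauses are continuity of [e] and
    uniform continuity of [d], with common prefixes measuring closeness of sequences. *)
Lemma brouwer_coding (X : MetricSpace) : cantor_space X ->
  exists (e : X -> nat -> bool) (d : (nat -> bool) -> X),
    (forall x, d (e x) = x) /\ (forall s, e (d s) = s) /\
    (forall x n, exists r, r > 0 /\ forall y, dist x y < r -> agree n (e x) (e y)) /\
    (forall eps, eps > 0 -> exists n, forall s t, agree n s t -> dist (d s) (d t) < eps).
Proof.
  intros [[x0] [HC [HI HT]]].
  destruct (separating_clopens X HC HT) as [B [HB Hsep]].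
  (* [epsilon] makes [sigma] total; its specification holds on nonempty clopen sets, and all cells
     are such. *)
  set (sigma := fun A B : X -> bool => epsilon (inhabits B) (splits X A B)).
  assert (Hsig : forall A n p, clopen X A -> A p = true -> splits X A (B n) (sigma A (B n))).
  { intros A n p HA Hp. apply epsilon_spec. now apply (splits_exist X A (B n) p). }
  assert (Hcell : forall w, clopen X (cell B sigma w) /\ exists y, cell B sigma w y = true).
  { intros w. induction w as [|b w [IH1 [p IH2]]]; simpl.
    - split; [apply clopen_const|exists x0; auto].
    - destruct (Hsig _ (length w) p IH1 IH2) as [H1 [H2 _]]. split.
      + apply clopen_map2; [auto|].
        apply (clopen_map2 X (fun c _ => Bool.eqb c b) _ (fun _ => true)); [auto|].
        apply clopen_const.
      + destruct (H2 b) as [y [Hy1 Hy2]]. exists y. rewrite Hy1, Hy2. apply eqb_reflx. }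
  set (e := code B sigma).
  assert (Hmem : forall s n x, cell B sigma (prefix s n) x = true <-> agree n s (e x))
    by (intros; apply cell_prefix_iff).
  (* Points with equal codes share their depth-[n] cell. If [B n] separated them, it would be the
     cut of that cell and their codes would differ at [n]. *)
  assert (Hinj : forall x y, e x = e y -> x = y).
  { intros x y E. apply Hsep. intros n. apply NNPP. intros Hn.
    assert (Hx : forall m, cell B sigma (prefix (e x) m) x = true)
      by (intros m; apply Hmem; intros k _; auto).
    assert (Hy : forall m, cell B sigma (prefix (e x) m) y = true)
      by (intros m; apply Hmem; intros k _; now rewrite E).
    destruct (Hsig _ n x (proj1 (Hcell (prefix (e x) n))) (Hx n)) as [_ [_ H]].
    rewrite <- H in Hn.
    - pose proof (Hx (S n)) as H1. pose proof (Hy (S n)) as H2. simpl in H1, H2.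
      rewrite prefix_length in H1, H2.
      apply andb_prop in H1. apply andb_prop in H2.
      destruct H1 as [_ H1], H2 as [_ H2].
      apply eqb_prop in H1. apply eqb_prop in H2. congruence.
    - intros b. destruct (Bool.bool_dec (B n x) b); [exists x; auto|].
      exists y. split; [auto|]. destruct (B n x), (B n y), b; congruence. }
  (* A cluster point of [u] stays in each cell along [s], since cells are closed; this yields both
     surjectivity and continuity of the inverse. *)
  assert (Hlim : forall s (u : nat -> X), (forall n, agree n s (e (u n))) ->
    exists z, e z = s /\ forall r, r > 0 -> exists i, dist z (u i) < r).
  { intros s u Hu. destruct (compact_cluster X u HC) as [z Hz]. exists z. split.
    - apply functional_extensionality. intros n. symmetry.
      assert (agree (S n) s (e z)) as H; [|apply H; lia].
      apply Hmem. apply (clopen_cluster X _ u z (S n)); [apply Hcell|auto|].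
      intros i Hi. apply Hmem. intros k Hk. apply Hu. lia.
    - intros r Hr. destruct (Hz r 0%nat Hr) as [i [_ H]]. eauto. }
  assert (Hsurj : forall s, exists x, e x = s).
  { intros s.
    assert (Hne : forall n, exists y, cell B sigma (prefix s n) y = true)
      by (intros n; apply Hcell).
    set (u := fun n => proj1_sig (constructive_indefinite_description _ (Hne n))).
    destruct (Hlim s u) as [z [Hz _]]; [|eauto].
    intros n. apply Hmem. unfold u. apply proj2_sig. }
  set (d := fun s => proj1_sig (constructive_indefinite_description _ (Hsurj s))).
  assert (Hed : forall s, e (d s) = s) by (intros s; unfold d; apply proj2_sig).
  assert (Hde : forall x, d (e x) = x) by (intros x; apply Hinj; auto).
  assert (Hec : forall x n, exists r, r > 0 /\
            forall y, dist x y < r -> agree n (e x) (e y)).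
  { intros x n. destruct (proj1 (Hcell (prefix (e x) n)) x) as [r [Hr H]].
    exists r. split; [auto|]. intros y Hy. apply Hmem. rewrite (H y Hy).
    apply Hmem. intros k _. auto. }
  assert (Hdc : forall s eps, eps > 0 -> exists n, forall t, agree n s t ->
            dist (d s) (d t) < eps).
  (* Otherwise points with codes tending to [s] stay at distance [eps] from [d s], yet they cluster
     at the point coded by [s]. *)
  { intros s eps He. apply NNPP. intros Hno.
    assert (Hbad : forall n, exists x, agree n s (e x) /\ eps <= dist (d s) x).
    { intros n. apply NNPP. intros Hn. apply Hno. exists n. intros t Ht.
      apply Rnot_le_lt. intros Hle. apply Hn. exists (d t). now rewrite Hed. }
    set (u := fun n => proj1_sig (constructive_indefinite_description _ (Hbad n))).
    assert (Hu : forall n, agree n s (e (u n)) /\ eps <= dist (d s) (u n))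
      by (intros n; unfold u; apply proj2_sig).
    destruct (Hlim s u) as [z [Hz Hzu]]; [intros n; apply Hu|].
    destruct (Hzu eps He) as [i Hi].
    rewrite <- Hz, Hde in Hu. destruct (Hu i). lra. }
  exists e, d. do 3 (split; [assumption|]).
  intros eps He.
  (* The prefix length is encoded through [/ r < INR n], so that one radius gives one length for all
     points. *)
  destruct (compact_uniform X
    (fun y r => forall n, / r < INR n -> forall t, agree n (e y) t -> dist y (d t) < eps)
    HC) as [r [Hr H]].
  - intros x r r' Hr H n Hn. apply H. eapply Rle_lt_trans; [|apply Hn].
    apply Rinv_le_contravar; lra.
  - intros x. destruct (Hdc (e x) (eps / 2)) as [n Hn]; [lra|]. rewrite Hde in Hn.
    destruct (Hec x n) as [r [Hr H]].
    assert (HSn : 0 < INR (S n)) by (apply lt_0_INR; lia).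
    exists (Rmin r (/ INR (S n))).
    assert (Hp : 0 < Rmin r (/ INR (S n))).
    { apply Rmin_glb_lt; [lra|]. now apply Rinv_0_lt_compat. }
    split; [exact Hp|]. intros y Hy m Hm t Ht.
    assert (Hnm : (n < m)%nat).
    { assert (INR (S n) < INR m) as Hlt; [|apply INR_lt in Hlt; lia].
      eapply Rle_lt_trans; [|apply Hm]. rewrite <- (Rinv_inv (INR (S n))) at 1.
      apply Rinv_le_contravar; [auto|apply Rmin_r]. }
    assert (Hxy : agree n (e x) (e y))
      by (apply H; eapply Rlt_le_trans; [apply Hy|apply Rmin_l]).
    pose proof (Hn (e y) Hxy) as H1. rewrite Hde in H1.
    assert (H2 : dist x (d t) < eps / 2).
    { apply Hn. intros k Hk. rewrite (Hxy k Hk). apply Ht. lia. }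
    pose proof (dist_tri X y x (d t)) as H3. rewrite (dist_sym X y x) in H3. lra.
  - destruct (exists_nat_above (/ r)) as [n Hn]. exists n. intros s t Hst.
    apply (H (d s) n Hn). now rewrite Hed.
Qed.

(** * The binary odometer *)

(** With the least significant digit at index 0, [all_below true s n] is the carry into place [n]
    when adding 1, and [all_below false s n] the borrow when subtracting 1. *)
Fixpoint all_below (b : bool) (s : nat -> bool) (n : nat) : bool :=
  match n with 0%nat => true | S n => all_below b s n && Bool.eqb (s n) b end.

Definition odo (s : nat -> bool) (n : nat) : bool := xorb (s n) (all_below true s n).

Definition odo_inv (s : nat -> bool) (n : nat) : bool := xorb (s n) (all_below false s n).

Lemma all_below_agree (b : bool) (s t : nat -> bool) (n : nat) :
  agree n s t -> all_below b s n = all_below b t n.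
Proof.
  induction n as [|n IH]; intros H; simpl; [auto|].
  rewrite IH, (H n); auto. intros k Hk. apply H. lia.
Qed.

Lemma agree_weaken (m n : nat) (s t : nat -> bool) :
  (m <= n)%nat -> agree n s t -> agree m s t.
Proof. intros Hmn H k Hk. apply H. lia. Qed.

Lemma odo_agree (n : nat) (s t : nat -> bool) : agree n s t -> agree n (odo s) (odo t).
Proof.
  intros H k Hk. unfold odo. rewrite (H k Hk). f_equal. apply all_below_agree.
  apply (agree_weaken k n); [lia|auto].
Qed.

Lemma odo_inv_agree (n : nat) (s t : nat -> bool) :
  agree n s t -> agree n (odo_inv s) (odo_inv t).
Proof.
  intros H k Hk. unfold odo_inv. rewrite (H k Hk). f_equal. apply all_below_agree.
  apply (agree_weaken k n); [lia|auto].
Qed.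

Lemma all_below_odo (s : nat -> bool) (n : nat) :
  all_below false (odo s) n = all_below true s n.
Proof.
  induction n as [|n IH]; simpl; [auto|]. unfold odo at 2. rewrite IH.
  destruct (all_below true s n), (s n); auto.
Qed.

Lemma all_below_odo_inv (s : nat -> bool) (n : nat) :
  all_below true (odo_inv s) n = all_below false s n.
Proof.
  induction n as [|n IH]; simpl; [auto|]. unfold odo_inv at 2. rewrite IH.
  destruct (all_below false s n), (s n); auto.
Qed.

Lemma odo_odo_inv (s : nat -> bool) : odo (odo_inv s) = s.
Proof.
  apply functional_extensionality. intros n. unfold odo at 1.
  rewrite all_below_odo_inv. unfold odo_inv.
  now destruct (s n), (all_below false s n).
Qed.

Lemma odo_inv_odo (s : nat -> bool) : odo_inv (odo s) = s.
Proof.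
  apply functional_extensionality. intros n. unfold odo_inv at 1.
  rewrite all_below_odo. unfold odo.
  now destruct (s n), (all_below true s n).
Qed.

Fixpoint value (s : nat -> bool) (k : nat) : nat :=
  match k with 0 => 0 | S k => value s k + (if s k then 2 ^ k else 0) end%nat.

(** A carry out of the first [k] digits is worth [2 ^ k]. *)
Lemma value_odo (s : nat -> bool) (k : nat) :
  (value (odo s) k + (if all_below true s k then 2 ^ k else 0) = value s k + 1)%nat.
Proof.
  induction k as [|k IH]; simpl; [auto|]. unfold odo at 2.
  destruct (all_below true s k), (s k); simpl in *; lia.
Qed.

(** The first [k] digits count modulo [2 ^ k], so a period is a multiple of [2 ^ k] for every
    [k]. *)
Lemma odo_aperiodic : aperiodic odo.
Proof.
  intros n s E.
  assert (H : forall k m, exists c, (value (Nat.iter m odo s) k + c * 2 ^ k = value s k + m)%nat).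
  { intros k m. induction m as [|m [c IH]]; [exists 0%nat; simpl; lia|].
    simpl. pose proof (value_odo (Nat.iter m odo s) k) as Hv.
    destruct (all_below true (Nat.iter m odo s) k);
      [exists (S c)|exists c]; simpl; lia. }
  (* Depth [S n] suffices, as [2 ^ S n] exceeds the supposed period [S n]. *)
  destruct (H (S n) (S n)) as [c Hc]. rewrite E in Hc.
  pose proof (Nat.pow_gt_lin_r 2 (S n) ltac:(lia)).
  destruct c as [|c]; [lia|]. rewrite Nat.mul_succ_l in Hc.
  lia.
Qed.

(** * Density of the aperiodic homeomorphisms *)

(* [joinN N] and [(leftN N, rightN N)] are mutually inverse bijections between pairs of
   sequences and sequences which keep the first [N] terms of the left component in place. *)
Definition joinN (N : nat) (a b : nat -> bool) (k : nat) : bool :=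
  if (k <? N)%nat then a k
  else if Nat.even (k - N) then a (N + Nat.div2 (k - N))%nat else b (Nat.div2 (k - N)).

Definition leftN (N : nat) (s : nat -> bool) (k : nat) : bool :=
  if (k <? N)%nat then s k else s (2 * k - N)%nat.

Definition rightN (N : nat) (s : nat -> bool) (k : nat) : bool := s (N + 2 * k + 1)%nat.

Lemma leftN_join (N : nat) (a b : nat -> bool) : leftN N (joinN N a b) = a.
Proof.
  apply functional_extensionality. intros k. unfold leftN, joinN.
  destruct (Nat.ltb_spec k N); [reflexivity|].
  destruct (Nat.ltb_spec (2 * k - N) N); [lia|].
  replace (2 * k - N - N)%nat with (2 * (k - N))%nat by lia.
  rewrite Nat.even_mul, Nat.div2_double. simpl. f_equal. lia.
Qed.

Lemma rightN_join (N : nat) (a b : nat -> bool) : rightN N (joinN N a b) = b.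
Proof.
  apply functional_extensionality. intros k. unfold rightN, joinN.
  destruct (Nat.ltb_spec (N + 2 * k + 1) N); [lia|].
  replace (N + 2 * k + 1 - N)%nat with (S (2 * k)) by lia.
  rewrite Nat.div2_succ_double, Nat.even_succ, Nat.odd_mul. reflexivity.
Qed.

Lemma joinN_split (N : nat) (s : nat -> bool) : joinN N (leftN N s) (rightN N s) = s.
Proof.
  apply functional_extensionality. intros k. unfold leftN, rightN, joinN.
  destruct (Nat.ltb_spec k N); [reflexivity|].
  pose proof (Nat.div2_odd (k - N)) as Hd. rewrite <- Nat.negb_even in Hd.
  destruct (Nat.even (k - N)); simpl in Hd.
  - destruct (Nat.ltb_spec (N + Nat.div2 (k - N)) N); [lia|]. f_equal. lia.
  - f_equal. lia.
Qed.

Lemma joinN_agree (N n : nat) (a a' b b' : nat -> bool) :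
  agree n a a' -> agree n b b' -> agree n (joinN N a b) (joinN N a' b').
Proof.
  intros Ha Hb k Hk. unfold joinN.
  pose proof (Nat.div2_decr (k - N) (k - N) ltac:(lia)).
  pose proof (Nat.div2_odd (k - N)).
  destruct (Nat.ltb_spec k N); [auto|].
  destruct (Nat.even (k - N)); [apply Ha|apply Hb]; lia.
Qed.

Lemma leftN_agree (N n : nat) (s t : nat -> bool) :
  agree (N + 2 * n + 2) s t -> agree n (leftN N s) (leftN N t).
Proof.
  intros H k Hk. unfold leftN. destruct (Nat.ltb_spec k N); apply H; lia.
Qed.

Lemma rightN_agree (N n : nat) (s t : nat -> bool) :
  agree (N + 2 * n + 2) s t -> agree n (rightN N s) (rightN N t).
Proof. intros H k Hk. apply H. lia. Qed.

Lemma leftN_start (N : nat) (s : nat -> bool) : agree N (leftN N s) s.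
Proof. intros k Hk. unfold leftN. destruct (Nat.ltb_spec k N); [auto|lia]. Qed.

Lemma joinN_start (N : nat) (a b : nat -> bool) : agree N (joinN N a b) a.
Proof. intros k Hk. unfold joinN. destruct (Nat.ltb_spec k N); [auto|lia]. Qed.

(* The product [F x o] of self-maps of [X] and of [nat -> bool], transported to [X]. *)
Definition twist {X : Type} (e : X -> nat -> bool) (d : (nat -> bool) -> X) (N : nat)
    (F : X -> X) (o : (nat -> bool) -> nat -> bool) (y : X) : X :=
  d (joinN N (e (F (d (leftN N (e y))))) (o (rightN N (e y)))).

Lemma twist_cancel {X : Type} (e : X -> nat -> bool) (d : (nat -> bool) -> X) (N : nat)
    (F F' : X -> X) (o o' : (nat -> bool) -> nat -> bool) (y : X) :
  (forall x, d (e x) = x) -> (forall s, e (d s) = s) ->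
  (forall x, F (F' x) = x) -> (forall s, o (o' s) = s) ->
  twist e d N F o (twist e d N F' o' y) = y.
Proof.
  intros Hde Hed HF Ho. unfold twist.
  rewrite Hed, leftN_join, rightN_join, Hde, HF, Ho, Hed, joinN_split. auto.
Qed.

Lemma twist_continuous (X : MetricSpace) (e : X -> nat -> bool) (d : (nat -> bool) -> X)
    (N : nat) (F : X -> X) (o : (nat -> bool) -> nat -> bool) :
  (forall x n, exists r, r > 0 /\ forall y, dist x y < r -> agree n (e x) (e y)) ->
  (forall eps, eps > 0 -> exists n, forall s t, agree n s t -> dist (d s) (d t) < eps) ->
  continuous X F -> (forall n s t, agree n s t -> agree n (o s) (o t)) ->
  continuous X (twist e d N F o).
Proof.
  intros He Hd HF Ho y eps Heps.
  destruct (Hd eps Heps) as [n Hn].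
  destruct (He (F (d (leftN N (e y)))) n) as [r1 [Hr1 H1]].
  destruct (HF (d (leftN N (e y))) r1 Hr1) as [r2 [Hr2 H2]].
  destruct (Hd r2 Hr2) as [m Hm].
  destruct (He y (N + 2 * (n + m) + 2)%nat) as [r [Hr H]].
  exists r. split; [auto|]. intros z Hz. specialize (H z Hz).
  apply Hn, joinN_agree.
  - apply H1, H2, Hm, leftN_agree. eapply agree_weaken; [|apply H]. lia.
  - apply Ho, rightN_agree. eapply agree_weaken; [|apply H]. lia.
Qed.

(** The left component of [y] decodes to a point within [eta] of [y], and the image keeps the first
    [N] bits of the value of [F] there. *)
Lemma twist_close (X : MetricSpace) (e : X -> nat -> bool) (d : (nat -> bool) -> X)
    (N : nat) (F : X -> X) (o : (nat -> bool) -> nat -> bool) (eta r : R) (y : X) :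
  (forall x, d (e x) = x) ->
  (forall s t, agree N s t -> dist (d s) (d t) < eta) ->
  (forall x z, dist x z < eta -> dist (F x) (F z) < r / 2) -> eta <= r / 2 ->
  dist (F y) (twist e d N F o y) < r.
Proof.
  intros Hde HN HF Heta. unfold twist.
  set (x := d (leftN N (e y))). set (b := o (rightN N (e y))).
  assert (H1 : dist x y < eta).
  { rewrite <- (Hde y) at 1. apply HN, leftN_start. }
  apply HF in H1.
  assert (H2 : dist (d (joinN N (e (F x)) b)) (F x) < eta).
  { rewrite <- (Hde (F x)) at 2. apply HN, joinN_start. }
  pose proof (dist_tri X (F y) (F x) (d (joinN N (e (F x)) b))) as H3.
  rewrite (dist_sym X (F y) (F x)), (dist_sym X (F x) (d _)) in H3. lra.
Qed.

Lemma aperiodic_dense (X : MetricSpace) : cantor_space X ->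
  H_dense X (fun f => aperiodic (hf f)).
Proof.
  intros HX f r Hr.
  destruct (brouwer_coding X HX) as (e & d & Hde & Hed & He & Hd).
  destruct HX as [_ [HC _]].
  destruct (uniform_continuity X (hf f) (r / 2 / 2) HC (hf_cont X f)) as [d1 [Hd1 H1]];
    [lra|].
  destruct (uniform_continuity X (hinv f) (r / 2 / 2) HC (hinv_cont X f)) as [d2 [Hd2 H2]];
    [lra|].
  set (eta := Rmin (r / 2 / 2) (Rmin d1 d2)).
  assert (Hp : 0 < eta) by (unfold eta; repeat apply Rmin_glb_lt; lra).
  assert (Ha : eta <= r / 2 / 2) by apply Rmin_l.
  assert (Hb : eta <= Rmin d1 d2) by apply Rmin_r.
  pose proof (Rmin_l d1 d2). pose proof (Rmin_r d1 d2).
  destruct (Hd eta Hp) as [N HN].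
  exists {| hf := twist e d N (hf f) odo;
            hinv := twist e d N (hinv f) odo_inv;
            hinv_hf := fun y => twist_cancel e d N _ _ _ _ y Hde Hed
                                  (hinv_hf X f) odo_inv_odo;
            hf_hinv := fun y => twist_cancel e d N _ _ _ _ y Hde Hed
                                  (hf_hinv X f) odo_odo_inv;
            hf_cont := twist_continuous X e d N _ _ He Hd (hf_cont X f) odo_agree;
            hinv_cont := twist_continuous X e d N _ _ He Hd (hinv_cont X f) odo_inv_agree |}.
  split.
  (* [rightN] semiconjugates the twisted map to the odometer, so a periodic point would yield one of
     [odo]. *)
  - intros n y E. apply (odo_aperiodic n (rightN N (e y))). simpl hf in E.
    rewrite <- (iter_semiconj (fun z => rightN N (e z)) (twist e d N (hf f) odo) odo).
    + now rewrite E.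
    + intros z. unfold twist. now rewrite Hed, rightN_join.
  - apply Dh_lt; [auto| |]; intros y; simpl;
      apply (twist_close X e d N _ _ eta (r / 2) y); auto; intros x z Hxz;
      [apply H1|apply H2]; lra.
Qed.

(** * Closing an orbit *)

(** An orbit visits any ball around a cluster point at two times [i < j]; take [y] to be the earlier
    visit. *)
Lemma orbit_return (X : MetricSpace) (f : X -> X) (x : X) (r : R) :
  compact_space X -> r > 0 -> exists y n, dist y (Nat.iter (S n) f y) < r.
Proof.
  intros HC Hr.
  destruct (compact_cluster X (fun i => Nat.iter i f x) HC) as [z Hz].
  destruct (Hz (r / 2) 0%nat) as [i [_ Hi]]; [lra|].
  destruct (Hz (r / 2) (S i)) as [j [Hij Hj]]; [lra|].
  exists (Nat.iter i f x), (j - S i)%nat.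
  rewrite <- Nat.iter_add. replace (S (j - S i) + i)%nat with j by lia.
  pose proof (dist_tri X (Nat.iter i f x) z (Nat.iter j f x)) as H.
  rewrite (dist_sym X _ z) in H. lra.
Qed.

Lemma finite_min_radius (n : nat) (P : nat -> R -> Prop) :
  (forall i r r', 0 < r' <= r -> P i r -> P i r') ->
  (forall i, (i < n)%nat -> exists r, r > 0 /\ P i r) ->
  exists r, r > 0 /\ forall i, (i < n)%nat -> P i r.
Proof.
  intros Hmono. induction n as [|n IH]; intros H.
  - exists 1. split; [lra|]. intros i Hi. lia.
  - destruct IH as [r [Hr IH]]; [intros i Hi; apply H; lia|].
    destruct (H n) as [s [Hs K]]; [lia|].
    assert (Hp : 0 < Rmin r s) by (apply Rmin_glb_lt; auto).
    exists (Rmin r s). split; [auto|]. intros i Hi.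
    destruct (Nat.eq_dec i n) as [->|].
    + apply (Hmono n s); [|auto]. split; [auto|apply Rmin_r].
    + apply (Hmono i r); [|apply IH; lia]. split; [auto|apply Rmin_l].
Qed.

(* The involution exchanging [A] and [p A] by means of [p], where [q] is the inverse of [p]. *)
Definition swap {T : Type} (A : T -> bool) (p q : T -> T) (x : T) : T :=
  if A x then p x else if A (q x) then q x else x.

Lemma swap_involutive {T : Type} (A : T -> bool) (p q : T -> T) (x : T) :
  (forall x, q (p x) = x) -> (forall x, p (q x) = x) ->
  (forall x, A x = true -> A (p x) = false) -> swap A p q (swap A p q x) = x.
Proof.
  intros Hqp Hpq HA. unfold swap at 2. destruct (A x) eqn:E.
  - unfold swap. rewrite (HA x E), Hqp, E. auto.
  - destruct (A (q x)) eqn:E'.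
    + unfold swap. rewrite E'. auto.
    + unfold swap. rewrite E, E'. auto.
Qed.

Lemma swap_continuous (X : MetricSpace) (A : X -> bool) (p q : X -> X) :
  clopen X A -> continuous X p -> continuous X q -> continuous X (swap A p q).
Proof.
  intros HA Hp Hq x eps He.
  destruct (HA x) as [r1 [Hr1 H1]].
  destruct (clopen_preimage X A q HA Hq x) as [r2 [Hr2 H2]].
  destruct (Hp x eps He) as [r3 [Hr3 H3]].
  destruct (Hq x eps He) as [r4 [Hr4 H4]].
  (* Within [r] the branch of [swap] does not change; [eps] itself serves the identity branch. *)
  set (r := Rmin (Rmin r1 r2) (Rmin (Rmin r3 r4) eps)).
  assert (r <= Rmin r1 r2) by apply Rmin_l.
  assert (r <= Rmin (Rmin r3 r4) eps) by apply Rmin_r.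
  pose proof (Rmin_l r1 r2). pose proof (Rmin_r r1 r2).
  pose proof (Rmin_l (Rmin r3 r4) eps). pose proof (Rmin_r (Rmin r3 r4) eps).
  pose proof (Rmin_l r3 r4). pose proof (Rmin_r r3 r4).
  exists r. split; [unfold r; repeat apply Rmin_glb_lt; lra|].
  intros y Hy. unfold swap. rewrite (H1 y), (H2 y) by lra.
  destruct (A x); [apply H3; lra|]. destruct (A (q x)); [apply H4; lra|lra].
Qed.

Lemma swap_close (X : MetricSpace) (A : X -> bool) (p q : X -> X) (r : R) (x : X) :
  r > 0 -> (forall x, p (q x) = x) ->
  (forall x, A x = true -> dist x (p x) < r) -> dist x (swap A p q x) < r.
Proof.
  intros Hr Hpq H. unfold swap. destruct (A x) eqn:E; [auto|].
  destruct (A (q x)) eqn:E'; [|rewrite dist_refl; lra].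
  rewrite dist_sym. pose proof (H _ E') as H'. now rewrite Hpq in H'.
Qed.

Lemma iter_inj {T : Type} (f g : T -> T) (n : nat) (x y : T) :
  (forall a, g (f a) = a) -> Nat.iter n f x = Nat.iter n f y -> x = y.
Proof.
  intros H E. rewrite <- (iter_cancel f g n x H), E. now apply iter_cancel.
Qed.

Lemma aperiodic_near_periodic (X : MetricSpace) (f : homeo X) (r : R) :
  cantor_space X -> aperiodic (hf f) -> r > 0 ->
  exists (g : homeo X) y n, Dh X f g < r /\ Nat.iter (S n) (hf g) y = y.
Proof.
  intros [[x0] [HC [_ HT]]] Hap Hr.
  destruct (uniform_continuity X (hinv f) (r / 2) HC (hinv_cont X f)) as [d1 [Hd1 H1]];
    [lra|].
  (* [phi] will move points by less than [eta]: [r / 2] controls [g], and [d1] controls its inverse,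
     where [hinv f] is applied after [phi]. *)
  set (eta := Rmin (r / 2) d1).
  assert (Hp : 0 < eta) by (unfold eta; repeat apply Rmin_glb_lt; lra).
  assert (Ha : eta <= r / 2) by apply Rmin_l.
  assert (Hb : eta <= d1) by apply Rmin_r.
  destruct (orbit_return X (hf f) x0 eta HC Hp) as (y & n & Hy).
  set (p := Nat.iter (S n) (hf f)) in *. set (q := Nat.iter (S n) (hinv f)).
  assert (Hqp : forall x, q (p x) = x).
  { intros x. unfold p, q. apply iter_cancel, hinv_hf. }
  assert (Hpq : forall x, p (q x) = x).
  { intros x. unfold p, q. apply iter_cancel, hf_hinv. }
  assert (Hpc : continuous X p) by apply continuous_iter, hf_cont.
  assert (Hqc : continuous X q) by apply continuous_iter, hinv_cont.
  (* [A] must be disjoint from its first [n + 1] images, so that the swap leaves the orbit of [y]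
     alone until time [n + 1]. *)
  assert (HA : exists A, clopen X A /\ A y = true /\
    (forall x, A x = true -> dist x (p x) < eta) /\
    (forall i x, (i < S n)%nat -> A x = true -> A (Nat.iter (S i) (hf f) x) = false)).
  { destruct (finite_min_radius (S n)
      (fun i s => forall x z, dist y x < s -> dist y z < s ->
                  Nat.iter (S i) (hf f) x <> z)) as [s [Hs H]].
    - intros i s s' Hs H x z Hx Hz. apply H; lra.
    - intros i _.
      assert (Hd : 0 < dist y (Nat.iter (S i) (hf f) y)).
      { apply dist_gt0. intros E. exact (Hap i y (eq_sym E)). }
      set (c := dist y (Nat.iter (S i) (hf f) y)) in *.
      destruct (continuous_iter X (hf f) (S i) (hf_cont X f) y (c / 2)) as [s [Hs H]];
        [lra|].
      exists (Rmin s (c / 2)). split; [apply Rmin_glb_lt; lra|].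
      intros x z Hx Hz E.
      pose proof (H x (Rlt_le_trans _ _ _ Hx (Rmin_l _ _))) as H2. rewrite E in H2.
      pose proof (Rlt_le_trans _ _ _ Hz (Rmin_r _ _)) as H3.
      pose proof (dist_tri X y z (Nat.iter (S i) (hf f) y)) as H4.
      rewrite (dist_sym X z) in H4. unfold c in *. lra.
    (* The slack [eta - dist y (p y)] is shared between [dist x y] and [dist (p y) (p x)]. *)
    - destruct (Hpc y ((eta - dist y (p y)) / 2)) as [s' [Hs' H']]; [lra|].
      set (c := Rmin (Rmin s s') ((eta - dist y (p y)) / 2)).
      destruct (clopen_base X y c HC HT) as (A & HA & HAy & HAc).
      { unfold c. repeat apply Rmin_glb_lt; lra. }
      assert (c <= Rmin s s') by apply Rmin_l.
      assert (c <= (eta - dist y (p y)) / 2) by apply Rmin_r.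
      pose proof (Rmin_l s s'). pose proof (Rmin_r s s').
      exists A. split; [auto|]. split; [auto|]. split.
      + intros x Hx. pose proof (HAc x Hx). pose proof (H' x ltac:(lra)).
        pose proof (dist_tri X x y (p x)). pose proof (dist_tri X y (p y) (p x)).
        rewrite (dist_sym X x y) in *. lra.
      + intros i x Hi Hx. apply not_true_is_false. intros E.
        apply (H i Hi x (Nat.iter (S i) (hf f) x)); auto.
        * pose proof (HAc x Hx). lra.
        * pose proof (HAc _ E). lra. }
  destruct HA as (A & HA & HAy & HAc & HAd).
  set (phi := swap A p q).
  assert (Hphi : forall x, phi (phi x) = x).
  { intros x. apply swap_involutive; auto. intros z Hz. apply (HAd n z); auto. }
  assert (Hphic : continuous X phi) by (apply swap_continuous; auto).
  assert (Hclose : forall x, dist x (phi x) < eta) by (intros x; apply swap_close; auto).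
  assert (C1 : forall x, hinv f (phi (phi (hf f x))) = x).
  { intros x. now rewrite Hphi, hinv_hf. }
  assert (C2 : forall x, phi (hf f (hinv f (phi x))) = x).
  { intros x. now rewrite hf_hinv, Hphi. }
  exists {| hf := fun x => phi (hf f x); hinv := fun x => hinv f (phi x);
            hinv_hf := C1; hf_hinv := C2;
            hf_cont := continuous_comp X phi (hf f) Hphic (hf_cont X f);
            hinv_cont := continuous_comp X (hinv f) phi (hinv_cont X f) Hphic |}, y, n.
  split.
  - apply Dh_lt; [auto| |]; intros x; simpl.
    + pose proof (Hclose (hf f x)). lra.
    + apply H1. pose proof (Hclose x). lra.
  - simpl hf.
    assert (Horb : forall i, (i <= n)%nat ->
      Nat.iter i (fun x => phi (hf f x)) y = Nat.iter i (hf f) y).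
    { intros i. induction i as [|i IH]; intros Hi; [reflexivity|].
      simpl. rewrite IH by lia. change (phi (Nat.iter (S i) (hf f) y) = Nat.iter (S i) (hf f) y).
      unfold phi, swap. rewrite (HAd i y) by (auto; lia).
      destruct (A (q (Nat.iter (S i) (hf f) y))) eqn:E; [|reflexivity].
      (* [f^(i+1) y] in [f^(n+1) A] would put [y] in [f^(n-i) A]. *)
      exfalso. set (z := q (Nat.iter (S i) (hf f) y)) in *.
      assert (Hz : Nat.iter (S (n - S i)) (hf f) z = y).
      { apply (iter_inj (hf f) (hinv f) (S i)); [apply hinv_hf|].
        rewrite <- Nat.iter_add. replace (S i + S (n - S i))%nat with (S n) by lia.
        apply Hpq. }
      pose proof (HAd (n - S i)%nat z ltac:(lia) E) as H. rewrite Hz in H. congruence. }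
    (* At time [n + 1] the orbit reaches [p y], which lies in [p A], and [phi] sends it back to
       [y]. *)
    simpl. rewrite Horb by lia. change (phi (p y) = y).
    unfold phi, swap. rewrite Hqp, HAy. unfold p. rewrite (HAd n y) by auto. reflexivity.
Qed.

Theorem theorem1p4 (X : MetricSpace) (HX : cantor_space X) :
  exists G : homeo X -> Prop,
    H_Gdelta X G /\ H_dense X G /\
    forall f : homeo X, G f -> ~ topologically_stable X f.
Proof.
  exists (fun f => aperiodic (hf f)). split; [|split].
  (* [S n] leaves out the exponent 0, which fixes every point. *)
  - exists (fun n f => forall x, Nat.iter (S n) (hf f) x <> x). split.
    + intros n. apply no_period_open. apply HX.
    + intros g. reflexivity.
  - now apply aperiodic_dense.
  - intros f Hap Hst. destruct (Hst 1) as [delta [Hd H]]; [lra|].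
    destruct (aperiodic_near_periodic X f delta HX Hap Hd) as (g & y & n & Hg & Hy).
    destruct (H g Hg) as (h & _ & _ & Hh).
    apply (Hap n (h y)).
    now rewrite <- (iter_semiconj h (hf g) (hf f) (S n) y Hh), Hy.
Qed.
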